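(* Let $F$ be a totally complex binary form with real coefficients, and let $S=\{\alpha_1,\ldots,\alpha_n\}\subset\mathbb H^2$ be the multiset of upper-half-plane roots of $F$. Let $G\le \mathrm{SL}_2(\mathbb R)$ be a subgroup preserving $S$ as a multiset, i.e. $S\cdot M=S$ for every $M\in G$. Assume also that the induced action of $G$ on $\mathbb H^2$ has a unique common fixed point $P$, meaning that $P$ is the unique point of $\mathbb H^2$ with $P\cdot M=P$ for every $M\in G$. Then $$\xi_{\mathcal J}(F)=\xi_{\mathcal H}(F)=P .$$
   Context: $\mathbb H^2=\{x+iy:y>0\}$ is the upper half-plane with hyperbolic distance $d_H$, $\cosh d_H(x+iy,u+iv)=1+\frac{(x-u)^2+(y-v)^2}{2yv}$. $\mathrm{SL}_2(\mathbb R)$ acts on the right on $\mathbb H^2$: if $M^{-1}=\begin{pmatrix}a&b\\c&d\end{pmatrix}$ then $z\cdot M=M^{-1}z=\frac{az+b}{cz+d}$; $S\cdot M$ is the image multiset. A real binary form of degree $2n$ is totally complex if it has no real roots (in $\mathbb P^1(\mathbb R)$); then $F(X,Z)=a_0\prod_{i=1}^n (X-\alpha_iZ)(X-\overline{\alpha_i}Z)$ with $a_0\in\mathbb R\setminus\{0\}$, and $\alpha_1,\ldots,\alpha_n\in\mathbb H^2$ are its upper-half-plane roots (with multiplicity). Julia's zero $\xi_{\mathcal J}(F)$: let $\mathbb H^3=\{z+t\mathbf{j}: z\in\mathbb C,\ t>0\}$, with $\mathbb H^2\subset\mathbb H^3$ via $x+iy\mapsto x+y\mathbf{j}$, and for $w=z+t\mathbf{j}$,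 $\alpha\in\mathbb C$ put $d_H(w,\alpha)=\ln\frac{|z-\alpha|^2+t^2}{t}$. A form of degree $N$ is stable if none of its roots has multiplicity at least $N/2$. For stable $F$ with all complex roots $\beta_1,\ldots,\beta_{2n}$ (with multiplicity), $\xi_{\mathcal J}(F)$ is the unique point $w\in\mathbb H^3$ minimizing $\sum_{i=1}^{2n} d_H(w,\beta_i)$; for totally complex real $F$ it lies in $\mathbb H^2$. If $F$ is totally complex and not stable, then all $\alpha_i$ equal one point $\alpha$ and by convention $\xi_{\mathcal J}(F)=\alpha$. Hyperbolic zero $\xi_{\mathcal H}(F)$: it is the hyperbolic center of mass of $\alpha_1,\ldots,\alpha_n$, i.e. the unique point $Q\in\mathbb H^2$ minimizing $\sum_{i=1}^n\cosh d_H(Q,\alpha_i)$. *)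

(* Defs.v *)
From mathcomp Require Import all_boot all_order all_algebra.
From mathcomp Require Import all_classical all_reals all_analysis.
From mathcomp Require Import complex.
From mathcomp Require mpoly.
Import (canonicals, coercions) mpoly.

Set Implicit Arguments.
Unset Strict Implicit.
Unset Printing Implicit Defensive.

Import Order.TTheory GRing.Theory Num.Theory.

Local Open Scope classical_set_scope.
Local Open Scope complex_scope.
Local Open Scope ring_scope.

Section Minimizers.
Context {R : realType} {T : choiceType}.

Definition minimizers (D : set T) (f : T -> R) : set T :=
  [set x | D x /\ forall y, D y -> f x <= f y].

(* The unique minimizer of f on D; x0 if there is no minimizer or more than
   one.  Below x0 always lies outside D, so that a value in D is genuinely the
   unique minimizer. *)
Definition the_minimizer (x0 : T) (D : set T) (f : T -> R) : T :=
  xget x0 [set x | minimizers D f = [set x]].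

End Minimizers.

Section HyperbolicGeometry.
Context {R : realType}.
Implicit Types (z : R[i]) (w : R[i] * R).

Definition cosh (x : R) : R := (expR x + expR (- x)) / 2.

(* The inverse of cosh : [0, +oo[ -> [1, +oo[ *)
Definition arcosh (x : R) : R := ln (x + Num.sqrt (x ^+ 2 - 1)).

Definition H2 : set R[i] := [set z | 0 < complex.Im z].

Definition hdist2 (z z' : R[i]) : R :=
  arcosh (1 + ((complex.Re z - complex.Re z') ^+ 2 +
               (complex.Im z - complex.Im z') ^+ 2)
              / (2 * complex.Im z' * complex.Im z)).

(* The pair (z, t) stands for z + t j. *)
Definition H3 : set (R[i] * R) := [set w | 0 < w.2].

Definition H2_to_H3 z : R[i] * R := ((complex.Re z)%:C, complex.Im z).

(* Regularized distance from w in H^3 to the ideal point a in C *)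
Definition hdist3 w (a : R[i]) : R :=
  ln ((Normc.normc (w.1 - a) ^+ 2 + w.2 ^+ 2) / w.2).

Definition mobius (A : 'M[R]_2) z : R[i] :=
  ((A 0 0)%:C * z + (A 0 1)%:C) / ((A 1 0)%:C * z + (A 1 1)%:C).

Definition ract z (M : 'M[R]_2) : R[i] := mobius (invmx M) z.

Definition SL2_subgroup (G : set 'M[R]_2) : Prop :=
  [/\ forall M, G M -> \det M = 1,
      G 1%:M,
      forall M N, G M -> G N -> G (M *m N)
    & forall M, G M -> G (invmx M)].

End HyperbolicGeometry.

Section BinaryForms.
Context {R : realType}.
(* The variables X and Z are 'X_0 and 'X_1. *)
Implicit Types (F : mpoly.mpoly 2 R) (N : nat).

Definition form_at F (x z : R) : R := mpoly.meval (tnth [tuple x; z]) F.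

Definition totally_complex F : Prop :=
  forall x z : R, (x, z) <> (0, 0) -> form_at F x z <> 0.

(* F(X, 1) *)
Definition dehomog F : {poly R[i]} :=
  mpoly.mmap (polyC \o real_complex R) (tnth [tuple 'X; 1]) F.

(* The roots of F in C, with multiplicity; the point at infinity (1 : 0), which
   is never a root of a totally complex form, is left out. *)
Definition complex_roots F : seq R[i] :=
  sval (closed_field_poly_normal (dehomog F)).

Definition upper_roots F : seq R[i] :=
  [seq z <- complex_roots F | 0 < complex.Im z].

(* The second condition is about the root at infinity of a form F of degree N,
   whose multiplicity is N - deg F(X, 1). *)
Definition stable N F : Prop :=
  (forall b : R[i], root (dehomog F) b -> (2 * mup b (dehomog F) < N)%N) /\
  (((size (dehomog F)).-1 < N)%N -> (2 * (N - (size (dehomog F)).-1) < N)%N).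

(* Julia's zero of a totally complex form F of degree N.  In the non-stable case
   all the elements of upper_roots F coincide. *)
Definition julia_zero N F : R[i] * R :=
  if `[< stable N F >] then
    the_minimizer (0, 0) H3 (fun w => \sum_(b <- complex_roots F) hdist3 w b)
  else H2_to_H3 (head 0 (upper_roots F)).

Definition hyperbolic_zero F : R[i] :=
  the_minimizer 0 H2 (fun Q => \sum_(a <- upper_roots F) cosh (hdist2 Q a)).

End BinaryForms.

(* Main.v *)
Require Import Defs.
From mathcomp Require Import all_boot all_order all_algebra.
From mathcomp Require Import all_classical all_reals all_analysis.
From mathcomp Require Import complex.
From mathcomp Require mpoly.
From mathcomp Require Import ring lra.
Import (canonicals, coercions) mpoly.

Set Implicit Arguments.
Unset Strict Implicit.
Unset Printing Implicit Defensive.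

Import Order.TTheory GRing.Theory Num.Theory.

Local Open Scope classical_set_scope.
Local Open Scope complex_scope.
Local Open Scope ring_scope.

(** The form [coshd z w] is $\cosh d_H(z,w)$: up to sign, it is the Lorentzian
pairing of the vectors $(1, x, x^2+y^2)/y$ that represent points of the upper
half-plane on the hyperboloid.  Both zeros are read off from this linear
structure.

A positive combination $\sum_a w_a \cosh d(Q,a)$ is the pairing of $Q$ with a
timelike vector, hence equals $C \cosh d(Q,Q_0)$ for one point $Q_0$
([barycenter]).  When the multiset and the weights are invariant under the
group, so is $Q_0$, and uniqueness of the fixed point gives $Q_0 = P$
([invariant_barycenter]).

With weights 1 this says that the function defining the hyperbolic zero is
$C \cosh d(Q,P)$, whose only minimum is $P$.

With the invariant weights $1/\cosh d(P,a)$ it says that the ratios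
$r_a(Q) = \cosh d(Q,a)/\cosh d(P,a)$ have arithmetic mean $\cosh d(Q,P)$, which
expresses that $P$ is a critical point of $\sum_a \ln\cosh d(\cdot,a)$.  The
triangle inequality puts each $r_a(Q)$ strictly between $e^{-d}$ and $e^d$, where
$d = d(P,Q)$; as $\ln$ is strictly concave, it lies above its chord on this
interval, and the chord vanishes at $\cosh d$, so
$\sum_a \ln r_a(Q) > 0$ for $Q \neq P$ ([sum_ln_ratio_gt0]).  Thus $P$ is the
strict minimum of $\sum_a \ln\cosh d(\cdot,a)$ on the half-plane, without any
compactness argument.

Julia's function groups into pairs $a, \bar a$ of conjugate roots.  Projecting
a point of $\mathbb H^3$ orthogonally onto the half-plane does not increase the
contribution of a pair, which on the half-plane is
$2\ln(2\,\mathrm{Im}(a)\cosh d(\cdot,a))$; equality for a point off the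
half-plane forces the projection to be $a$ ([hdist3_proj_H2]).  So
$P$ is the strict minimum as soon as the upper roots are not all equal to $P$
([julia_minimizer]).  A totally complex form is stable exactly when its upper
roots are not all equal ([stableE]); when they are, the common root is fixed by
the group, hence is $P$. *)

(** * The hyperbolic cosine of the distance *)

Section HyperbolicCosine.
Context {R : realType}.
Implicit Types z w a p q : R[i].

Definition sqn z : R := complex.Re z ^+ 2 + complex.Im z ^+ 2.

Lemma sqn_ge0 z : 0 <= sqn z.
Proof. by rewrite addr_ge0 ?sqr_ge0. Qed.

Lemma sqnM z w : sqn (z * w) = sqn z * sqn w.
Proof. by case: z w => [a b] [c d]; rewrite /sqn /=; ring. Qed.

Lemma sqn_eq0 z : (sqn z == 0) = (z == 0).
Proof.
by case: z => a b; rewrite eq_complex /= /sqn /= paddr_eq0 ?sqr_ge0 // !sqrf_eq0.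
Qed.

Lemma sqn_gt0 z : z != 0 -> 0 < sqn z.
Proof. by move=> z0; rewrite lt_def sqn_eq0 z0 sqn_ge0. Qed.

Lemma sqnV z : sqn z^-1 = (sqn z)^-1.
Proof.
have [->|z0] := eqVneq z 0.
  by rewrite invr0 (eqP (_ : sqn 0 == 0)) ?invr0 // sqn_eq0.
apply: (@mulfI _ (sqn z)); first by rewrite sqn_eq0.
by rewrite -sqnM !mulfV ?sqn_eq0 // /sqn /= expr1n expr0n addr0.
Qed.

Lemma sqn_normc z : Normc.normc z ^+ 2 = sqn z.
Proof. by case: z => a b; rewrite /= sqr_sqrtr // addr_ge0 ?sqr_ge0. Qed.

Definition coshd z w : R :=
  1 + sqn (z - w) / (2 * complex.Im w * complex.Im z).

Lemma coshdE z w : H2 z -> H2 w ->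
  coshd z w = ((complex.Re z - complex.Re w) ^+ 2 + complex.Im z ^+ 2 +
     complex.Im w ^+ 2) / (2 * complex.Im w * complex.Im z).
Proof.
case: z w => [x y] [u v]; rewrite /H2 /coshd /sqn /= => y0 v0.
by field; rewrite !gt_eqF.
Qed.

Lemma coshd_ge1 z w : H2 z -> H2 w -> 1 <= coshd z w.
Proof.
move=> Hz Hw; rewrite lerDl divr_ge0 ?sqn_ge0 //.
by rewrite !mulr_ge0 // ltW.
Qed.

Lemma coshd_gt0 z w : H2 z -> H2 w -> 0 < coshd z w.
Proof. by move=> Hz Hw; rewrite (lt_le_trans ltr01) ?coshd_ge1. Qed.

Lemma coshdxx z : coshd z z = 1.
Proof. by rewrite /coshd subrr /sqn /= expr0n addr0 mul0r addr0. Qed.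

Lemma coshd_eq1 z w : H2 z -> H2 w -> coshd z w = 1 -> z = w.
Proof.
move=> Hz Hw /eqP; rewrite -subr_eq0 addrAC subrr add0r mulf_eq0 sqn_eq0.
have /gt_eqF -> : 0 < (2 * complex.Im w * complex.Im z)^-1.
  by rewrite invr_gt0 !mulr_gt0.
by rewrite orbF subr_eq0 => /eqP.
Qed.

Lemma coshd_gt1 z w : H2 z -> H2 w -> z != w -> 1 < coshd z w.
Proof.
move=> Hz Hw zw; rewrite lt_def coshd_ge1 // andbT.
by apply: contraNneq zw => /(coshd_eq1 Hz Hw) ->.
Qed.

Lemma cosh_arcosh (x : R) : 1 <= x -> Defs.cosh (Defs.arcosh x) = x.
Proof.
move=> x1; rewrite /Defs.cosh /Defs.arcosh.
set s := Num.sqrt _.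
have s0 : 0 <= s by exact: sqrtr_ge0.
have s2 : s ^+ 2 = x ^+ 2 - 1.
  by rewrite sqr_sqrtr // subr_ge0 expr_ge1 // (le_trans ler01).
have u0 : 0 < x + s by lra.
rewrite expRN lnK ?posrE //.
have -> : (x + s)^-1 = x - s.
  apply: (@mulfI _ (x + s)); first by rewrite gt_eqF.
  by rewrite mulfV ?gt_eqF // mulrC -subr_sqr s2; ring.
by field.
Qed.

Lemma cosh_hdist2 z w : H2 z -> H2 w -> Defs.cosh (hdist2 z w) = coshd z w.
Proof.
case: z w => [x y] [u v] Hz Hw; rewrite /hdist2 cosh_arcosh //.
exact: (coshd_ge1 Hz Hw).
Qed.

Section Mobius.
Variables (A : 'M[R]_2).
Hypothesis detA : \det A = 1.

Let den z := (A 1 0)%:C * z + (A 1 1)%:C.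

Lemma mobius_det : A 0 0 * A 1 1 - A 0 1 * A 1 0 = 1.
Proof.
rewrite -detA (expand_det_row _ 0) !big_ord_recl big_ord0 addr0.
rewrite /cofactor !det_mx11 !mxE /= expr0 expr1 mul1r mulN1r mulrN.
by congr (_ * A _ _ - A _ _ * A _ _); apply: val_inj.
Qed.

Lemma mobius_den_neq0 z : H2 z -> den z != 0.
Proof.
case: z => x y; rewrite /H2 /= => y0; apply/eqP; rewrite /den; simpc.
case=> h1 /eqP; rewrite mulf_eq0 (gt_eqF y0) orbF => /eqP c0.
move: h1; rewrite c0 mul0r add0r => d0.
by move: mobius_det; rewrite c0 d0 !mulr0 subrr => /eqP; rewrite eq_sym oner_eq0.
Qed.

Lemma Im_mobius z : H2 z ->
  complex.Im (mobius A z) = complex.Im z / sqn (den z).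
Proof.
move=> Hz; have := sqn_gt0 (mobius_den_neq0 Hz).
move: mobius_det; rewrite /mobius /den /sqn; case: z Hz => x y _.
set a := A 0 0; set b := A 0 1; set c := A 1 0; set d := A 1 1 => D.
simpc => /= N0.
rewrite -[X in _ = X / _]mul1r -D.
by field; rewrite gt_eqF.
Qed.

Lemma mobius_H2 z : H2 z -> H2 (mobius A z).
Proof.
move=> Hz; rewrite /H2 /= Im_mobius // divr_gt0 //.
by rewrite sqn_gt0 // mobius_den_neq0.
Qed.

(** The denominators are the automorphy factors whose square norms also divide
    the imaginary parts, so that they cancel in [coshd]. *)
Lemma mobiusB z w : H2 z -> H2 w ->
  mobius A z - mobius A w = (z - w) / (den z * den w).
Proof.
move=> /mobius_den_neq0 + /mobius_den_neq0; rewrite /mobius /den => z0 w0.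
have -> : z - w = (A 0 0 * A 1 1 - A 0 1 * A 1 0)%:C * (z - w).
  by rewrite mobius_det mul1r.
rewrite rmorphB !rmorphM.
by field; rewrite z0 w0.
Qed.

Lemma coshd_mobius z w : H2 z -> H2 w ->
  coshd (mobius A z) (mobius A w) = coshd z w.
Proof.
move=> Hz Hw; rewrite /coshd mobiusB // !Im_mobius // sqnM sqnV sqnM.
have := sqn_gt0 (mobius_den_neq0 Hz); have := sqn_gt0 (mobius_den_neq0 Hw).
move: Hz Hw; rewrite /H2 /= => y0 v0 n0 m0.
by congr (1 + _); field; rewrite !gt_eqF.
Qed.

End Mobius.

End HyperbolicCosine.

(** * Centers of mass in the half-plane *)

Section Barycenter.
Context {R : realType}.
Implicit Types (z a p q Q : R[i]) (s U : seq R[i]).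

Lemma ltr_sum_mem (I : eqType) (r : seq I) (f g : I -> R) :
  r != [::] -> {in r, forall i, f i < g i} ->
  \sum_(i <- r) f i < \sum_(i <- r) g i.
Proof.
move=> r0 fg; rewrite big_seq [ltRHS]big_seq; apply: ltr_sum => //.
by case: r r0 {fg} => // a l _ /=; rewrite inE eqxx.
Qed.

(** [coshd Q a] is a quadratic polynomial in the coordinates of [Q], divided by
    [Im Q]; a positive combination has the same shape, and completing the square
    exhibits [Q0]. *)
Lemma barycenter U (w : R[i] -> R) :
    U != [::] -> {in U, forall a, H2 a /\ 0 < w a} ->
  exists Q0 : R[i], exists C : R, [/\ H2 Q0, 0 < C &
    forall Q, H2 Q -> \sum_(a <- U) w a * coshd Q a = C * coshd Q Q0].
Proof.
move=> U0 HU.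
pose S (f : R -> R -> R) :=
  \sum_(a <- U) w a / complex.Im a * f (complex.Re a) (complex.Im a).
have S_gt0 f : (forall u v, 0 < v -> 0 < f u v) -> 0 < S f.
  move=> f0; rewrite (le_lt_trans _ (@ltr_sum_mem _ U (fun=> 0) _ U0 _)) ?big1 //.
  by move=> a /HU[Ha wa]; rewrite mulr_gt0 ?f0 // divr_gt0.
have A0 : 0 < S (fun _ _ => 1) by exact: S_gt0.
set A := S _ in A0; set B := S (fun u _ => u).
set D := S (fun u v => u ^+ 2 + v ^+ 2).
(* The combination is (A (x^2 + y^2) - 2 B x + D) / (2 y), with minimum at
   x = B / A, y^2 = D / A - (B / A)^2; this variance-like quantity is positive. *)
pose x0 := B / A.
have E0 : 0 < D - x0 ^+ 2 * A.
  have -> : D - x0 ^+ 2 * A = S (fun u v => (u - x0) ^+ 2 + v ^+ 2).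
    transitivity (D - 2 * x0 * B + x0 ^+ 2 * A).
      by rewrite /x0; field; rewrite gt_eqF.
    rewrite /D /B /A /S !mulr_sumr -sumrB -big_split /=.
    by apply: eq_bigr => a _; ring.
  by apply: S_gt0 => u v v0; rewrite ltr_wpDl ?sqr_ge0 // exprn_gt0.
pose y0 := Num.sqrt (D / A - x0 ^+ 2).
have y02 : y0 ^+ 2 = D / A - x0 ^+ 2.
  rewrite sqr_sqrtr // ltW // -(pmulr_lgt0 _ A0).
  by rewrite mulrBl mulfVK ?gt_eqF.
have y0_gt0 : 0 < y0.
  rewrite sqrtr_gt0 -(pmulr_lgt0 _ A0).
  by rewrite mulrBl mulfVK ?gt_eqF.
exists (x0 +i* y0), (A * y0); split => //; first by rewrite mulr_gt0.
move=> Q HQ; rewrite coshdE //.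
have Q0 : 0 < complex.Im Q by [].
transitivity ((A * (complex.Re Q ^+ 2 + complex.Im Q ^+ 2) - 2 * complex.Re Q * B + D)
   / (2 * complex.Im Q)).
  rewrite /A /B /D /S !mulr_suml !mulr_sumr -sumrB -big_split /= mulr_suml.
  rewrite big_seq [RHS]big_seq; apply: eq_bigr => a /HU[Ha wa].
  rewrite coshdE //; have v0 : 0 < complex.Im a by [].
  by field; rewrite !gt_eqF.
rewrite /= y02 /x0.
by field; rewrite !gt_eqF.
Qed.

Section Invariance.
Variables (G : set 'M[R]_2) (U : seq R[i]) (P : R[i]).
Hypotheses (U_neq0 : U != [::]) (UH : {in U, forall a, H2 a}).
Hypothesis detG : forall M, G M -> \det M = 1.
Hypothesis U_invariant :
  forall M, G M -> perm_eq [seq ract z M | z <- U] U.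
Hypothesis P_fixed : forall M, G M -> ract P M = P.
Hypothesis P_unique :
  forall Q, H2 Q -> (forall M, G M -> ract Q M = Q) -> Q = P.

Lemma ract_H2 M z : G M -> H2 z -> H2 (ract z M).
Proof. by move=> GM; apply: mobius_H2; rewrite det_inv detG // invr1. Qed.

Lemma coshd_ract M z w : G M -> H2 z -> H2 w ->
  coshd (ract z M) (ract w M) = coshd z w.
Proof. by move=> GM; apply: coshd_mobius; rewrite det_inv detG // invr1. Qed.

(** [Q0] is the only point where the combination takes the value [C]; the group
    preserves the combination, hence fixes [Q0]. *)
Lemma invariant_barycenter (w : R[i] -> R) :
    {in U, forall a, 0 < w a} ->
    (forall M, G M -> {in U, forall a, w (ract a M) = w a}) ->
  exists2 C : R, 0 < C &
    forall Q, H2 Q -> \sum_(a <- U) w a * coshd Q a = C * coshd Q P.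
Proof.
move=> w0 wG.
have [|Q0 [C [HQ0 C0 fE]]] := @barycenter U w U_neq0.
  by move=> a aU; split; [exact: UH|exact: w0].
exists C => // Q HQ; rewrite -(P_unique HQ0) ?fE // => M GM.
apply: (coshd_eq1 _ HQ0); first exact: ract_H2.
apply: (mulfI (lt0r_neq0 C0)); rewrite mulr1 -fE; last exact: ract_H2.
rewrite -(perm_big _ (U_invariant GM)) big_map /=.
transitivity (\sum_(a <- U) w a * coshd Q0 a); last by rewrite fE // coshdxx mulr1.
rewrite big_seq [RHS]big_seq; apply: eq_bigr => a aU.
by rewrite wG // coshd_ract //; exact: UH.
Qed.

Lemma sum_coshd : exists2 C : R, 0 < C &
  forall Q, H2 Q -> \sum_(a <- U) coshd Q a = C * coshd Q P.
Proof.
have [||C C0 fE] := @invariant_barycenter (fun=> 1).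
- by move=> a _; exact: ltr01.
- by [].
by exists C => // Q HQ; rewrite -fE //; apply: eq_bigr => a _; rewrite mul1r.
Qed.

(** For the weights [1 / coshd P a], taking [Q = P] shows that [C] is the number
    of points. *)
Lemma sum_coshd_ratio Q : H2 P -> H2 Q ->
  \sum_(a <- U) coshd Q a / coshd P a = (size U)%:R * coshd Q P.
Proof.
move=> HP HQ; have [||C C0 fE] := @invariant_barycenter (fun a => (coshd P a)^-1).
- by move=> a /UH Ha; rewrite invr_gt0 coshd_gt0.
- by move=> M GM a /UH Ha; rewrite -{1}(P_fixed GM) coshd_ract.
have fE' Q' : H2 Q' -> \sum_(a <- U) coshd Q' a / coshd P a = C * coshd Q' P.
  by move=> HQ'; rewrite -fE //; apply: eq_bigr => a _; rewrite mulrC.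
rewrite fE' //; congr (_ * _).
have := fE' P HP; rewrite coshdxx mulr1 => <-.
rewrite big_seq (eq_bigr (fun=> 1)); last first.
  by move=> a /UH Ha; rewrite mulfV // gt_eqF // coshd_gt0.
by rewrite -big_seq big_const_seq count_predT iter_addr addr0.
Qed.
End Invariance.

(** The Gram determinant of three vectors in signature (2, 1) has a constant
    sign: it is a fixed multiple of the square of their determinant. *)
Lemma coshd_gram p q a : H2 p -> H2 q -> H2 a ->
  0 <= 1 + 2 * coshd q p * coshd p a * coshd q a
       - coshd q p ^+ 2 - coshd p a ^+ 2 - coshd q a ^+ 2.
Proof.
move=> Hp Hq Ha; rewrite !coshdE //.
case: p q a Hp Hq Ha => [x y] [x' y'] [u v]; rewrite /H2 /= => y0 y'0 v0.
pose det : R := (x' - x) * (u ^+ 2 + v ^+ 2) + (x - u) * (x' ^+ 2 + y' ^+ 2)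
   + (u - x') * (x ^+ 2 + y ^+ 2).
rewrite (_ : _ - _ = (det / (2 * y * y' * v)) ^+ 2) ?sqr_ge0 //.
by rewrite /det; field; rewrite !gt_eqF.
Qed.

(** The left-hand side is affine in [r] and equals [- ln q] and
    [ln q] at the endpoints.  Writing [r = A * q + B * q^-1] with
    [A + B = 1] and dividing by [expR ((A - B) * ln q)], the claim becomes
    [1 < A * expR (2 * B * ln q) + B * expR (- (2 * A * ln q))], which follows from
    [1 + x < expR x]. *)
Lemma ln_gt_chord (q r : R) : 1 < q -> q^-1 < r < q ->
  ln q / (q - q^-1) * (2 * r - (q + q^-1)) < ln r.
Proof.
move=> q1 /andP[qr rq].
have q0 : 0 < q by lra.
have qV : q^-1 < 1 by rewrite invf_lt1.
have qV0 : 0 < q^-1 by rewrite invr_gt0.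
have d0 : 0 < q - q^-1 by lra.
(* [A] and [B] are the barycentric coordinates of [r] in the interval. *)
pose A := (r - q^-1) / (q - q^-1); pose B := (q - r) / (q - q^-1).
have A0 : 0 < A by apply: divr_gt0; lra.
have B0 : 0 < B by apply: divr_gt0; lra.
have AB : A + B = 1 by rewrite -mulrDl addrC addrA subrK mulfV ?gt_eqF.
have rE : r = A * q + B * q^-1.
  apply: (mulIf (lt0r_neq0 d0)).
  rewrite /A /B mulrDl ![_ * _ * (q - _)]mulrAC !mulfK ?gt_eqF //.
  by ring.
set L := ln q.
have L0 : 0 < L by rewrite ln_gt0.
have -> : L / (q - q^-1) * (2 * r - (q + q^-1)) = (A - B) * L.
  by rewrite /A /B; ring.
clearbody A B.
rewrite -ltr_expR lnK ?posrE; last by lra.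
rewrite rE.
have eB : q = expR ((A - B) * L) * expR (2 * B * L).
  rewrite -expRD -mulrDl (_ : A - B + 2 * B = A + B); last by ring.
  by rewrite AB mul1r lnK.
have eA : q^-1 = expR ((A - B) * L) * expR (- (2 * A * L)).
  rewrite -expRD -mulNr -mulrDl (_ : A - B + - (2 * A) = - (A + B)); last by ring.
  by rewrite AB mulN1r expRN lnK.
rewrite [X in A * X]eB eA !(mulrCA _ (expR ((A - B) * L))) -mulrDr.
rewrite ltr_pMr ?expR_gt0 //.
have hB : 1 + 2 * B * L < expR (2 * B * L).
  by rewrite expR_gt1Dx // gt_eqF // !mulr_gt0.
have hA : 1 - 2 * A * L < expR (- (2 * A * L)).
  by rewrite expR_gt1Dx // oppr_eq0 gt_eqF // !mulr_gt0.
rewrite -[ltLHS]AB.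
have -> : A + B = A * (1 + 2 * B * L) + B * (1 - 2 * A * L) by ring.
by apply: ltrD; rewrite ltr_pM2l.
Qed.

(** Here [e] is the exponential of the distance from [p] to [q], so this is the
    strict triangle inequality in multiplicative form.  By [coshd_gram] the ratio
    lies strictly between the two roots of $X^2 - 2 \cosh d(q,p) X + 1$. *)
Lemma coshd_ratio_bound p q a (e := coshd q p + Num.sqrt (coshd q p ^+ 2 - 1)) :
    H2 p -> H2 q -> H2 a -> p != q ->
  [/\ 1 < e, e + e^-1 = 2 * coshd q p & e^-1 < coshd q a / coshd p a < e].
Proof.
move=> Hp Hq Ha pq.
have c1 : 1 < coshd q p by apply: coshd_gt1; rewrite // eq_sym.
have l0 := coshd_gt0 Hp Ha; have m0 := coshd_gt0 Hq Ha.
have := coshd_gram Hp Hq Ha; rewrite /e.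
set c := coshd q p in c1 *; set l := coshd p a in l0 *; set m := coshd q a in m0 *.
move=> gram; set s := Num.sqrt _.
have s2 : s ^+ 2 = c ^+ 2 - 1.
  by rewrite sqr_sqrtr // subr_ge0 expr_ge1 //; lra.
have s0 : 0 < s by rewrite sqrtr_gt0 subr_gt0 expr_gt1 //; lra.
have eV : (c + s)^-1 = c - s.
  have e0 : c + s != 0 by rewrite gt_eqF //; lra.
  by apply: (mulfI e0); rewrite mulfV // mulrC -subr_sqr s2; ring.
rewrite eV; split; [lra|ring|].
have : `|m / l - c| < s.
  rewrite -(ltr_pXn2r (ltn0Sn 1)) ?nnegrE // ?ltW // real_normK ?num_real //.
  rewrite s2 -subr_gt0.
  have -> : c ^+ 2 - 1 - (m / l - c) ^+ 2 =
      ((1 + 2 * c * l * m - c ^+ 2 - l ^+ 2 - m ^+ 2) + (c ^+ 2 - 1)) / l ^+ 2.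
    by field; rewrite gt_eqF.
  rewrite divr_gt0 ?exprn_gt0 // ltr_wpDl // subr_gt0 expr_gt1 //; lra.
by rewrite ltr_norml => /andP[h1 h2]; apply/andP; split; lra.
Qed.

(** Each logarithm exceeds the chord, and the chord sums to zero by the
    hypothesis on the mean of the ratios. *)
Lemma sum_ln_ratio_gt0 U p q : U != [::] -> {in U, forall a, H2 a} ->
    H2 p -> H2 q -> p != q ->
    \sum_(a <- U) coshd q a / coshd p a = (size U)%:R * coshd q p ->
  0 < \sum_(a <- U) ln (coshd q a / coshd p a).
Proof.
move=> U0 UH Hp Hq pq sumE.
pose e := coshd q p + Num.sqrt (coshd q p ^+ 2 - 1).
have eP a (Ha : H2 a) := coshd_ratio_bound Hp Hq Ha pq.
rewrite [ltLHS](_ : 0 = \sum_(a <- U)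
   ln e / (e - e^-1) * (2 * (coshd q a / coshd p a) - (e + e^-1))); last first.
  rewrite -mulr_sumr sumrB -mulr_sumr sumE big_const_seq count_predT iter_addr addr0.
  by have [_ -> _] := eP _ Hp; rewrite -mulr_natl; ring.
by apply: ltr_sum_mem => // a /UH /eP[e1 _ r]; exact: ln_gt_chord.
Qed.
End Barycenter.

(** * Julia's function *)

Section Julia.
Context {R : realType}.
Implicit Types (z a p q Q : R[i]) (s U : seq R[i]) (w : R[i] * R).

Lemma the_minimizer_eq (T : choiceType) (x0 x : T) (D : set T) (f : T -> R) :
  D x -> (forall y, D y -> y <> x -> f x < f y) -> the_minimizer x0 D f = x.
Proof.
move=> Dx fx; have minE : minimizers D f = [set x].
  apply/seteqP; split => [y [Dy fy]|y ->].
    by apply/eqP/negPn/negP => /eqP /(fx _ Dy); rewrite ltNge fy.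
  by split=> // y' Dy'; have [->//|/eqP/(fx _ Dy')/ltW] := eqVneq y' x.
apply: xget_unique => // y /=; rewrite minE => /seteqP[/(_ x erefl)].
by [].
Qed.

(** The foot of the perpendicular from [w] to the plane of the points $x + t j$
    with $x$ real: the geodesics orthogonal to this plane are half-circles centered
    on the real axis. *)
Definition proj_H2 w : R[i] :=
  complex.Re w.1 +i* Num.sqrt (complex.Im w.1 ^+ 2 + w.2 ^+ 2).

Lemma H2_proj_H2 w : H3 w -> H2 (proj_H2 w).
Proof.
rewrite /H3 /H2 /= => t0.
by rewrite sqrtr_gt0 ltr_wpDl ?sqr_ge0 // exprn_gt0.
Qed.

Lemma hdist3_conj_pair w a : H3 w ->
  expR (hdist3 w a + hdist3 w (conjc a)) =
   (sqn (w.1 - a) + w.2 ^+ 2) * (sqn (w.1 - conjc a) + w.2 ^+ 2) / w.2 ^+ 2.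
Proof.
rewrite /H3 /= => t0.
have N b : 0 < (sqn (w.1 - b) + w.2 ^+ 2) / w.2.
  by rewrite divr_gt0 // ltr_wpDl ?sqn_ge0 // exprn_gt0.
rewrite expRD /hdist3 !sqn_normc !lnK ?posrE //.
by field; rewrite gt_eqF.
Qed.

Lemma expR_2ln (x : R) : 0 < x -> expR (2 * ln x) = x ^+ 2.
Proof. by move=> x0; rewrite mulr_natl mulr2n expRD lnK. Qed.

Lemma hdist3_H2_to_H3 q a : H2 q -> H2 a ->
  hdist3 (H2_to_H3 q) a + hdist3 (H2_to_H3 q) (conjc a) =
  2 * ln (2 * complex.Im a * coshd q a).
Proof.
move=> Hq Ha; have K := coshd_gt0 Hq Ha.
have v0 : 0 < complex.Im a by [].
have y0 : 0 < complex.Im q by [].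
apply: (@expR_inj R); rewrite hdist3_conj_pair // expR_2ln ?mulr_gt0 // coshdE //.
case: q a {Hq Ha K} v0 y0 => [x y] [u v] /= v0 y0; rewrite /sqn /=.
by field; rewrite !gt_eqF.
Qed.

(** With [s = Im w.1], [t = w.2], [h = Im (proj_H2 w)] and
    $E = 2 h\,\mathrm{Im}(a) \cosh d$,
    the exponentials of the two sides differ by
    $s^2 (E^2 - 4\,\mathrm{Im}(a)^2 h^2) / (t^2 h^2)$, and
    $E - 2\,\mathrm{Im}(a) h$ is the squared euclidean distance from [proj_H2 w] to
    [a]. *)
Lemma hdist3_proj_H2 w a : H3 w -> H2 a ->
  2 * ln (2 * complex.Im a * coshd (proj_H2 w) a) <= hdist3 w a + hdist3 w (conjc a)
    ?= iff (complex.Im w.1 == 0) || (proj_H2 w == a).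
Proof.
move=> Hw Ha; have Hp := H2_proj_H2 Hw; have K := coshd_gt0 Hp Ha.
have v0 : 0 < complex.Im a by [].
have h0 : 0 < complex.Im (proj_H2 w) by [].
have t0 : 0 < w.2 by [].
have h2 : complex.Im (proj_H2 w) ^+ 2 = complex.Im w.1 ^+ 2 + w.2 ^+ 2.
  by rewrite /= sqr_sqrtr // addr_ge0 ?sqr_ge0.
have E : expR (hdist3 w a + hdist3 w (conjc a)) -
     expR (2 * ln (2 * complex.Im a * coshd (proj_H2 w) a)) =
   complex.Im w.1 ^+ 2 * (2 * complex.Im a * coshd (proj_H2 w) a + 2 * complex.Im a)
    * sqn (proj_H2 w - a) / (complex.Im (proj_H2 w) * w.2 ^+ 2).
  rewrite hdist3_conj_pair // expR_2ln ?mulr_gt0 // coshdE //.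
  have -> : sqn (proj_H2 w - a) = (complex.Re w.1 - complex.Re a) ^+ 2 +
    (complex.Im (proj_H2 w) - complex.Im a) ^+ 2 by case: (a).
  rewrite [complex.Re (proj_H2 w)]/=.
  move: (complex.Im (proj_H2 w)) h2 h0 => h h2 h0.
  case: w a {Hw Ha Hp K} v0 t0 h2 => [[x s] t] [u v] /= v0 t0 h2; rewrite /sqn /=.
  have -> : ((x - u) ^+ 2 + (s - v) ^+ 2 + t ^+ 2) *
     ((x - u) ^+ 2 + (s - - v) ^+ 2 + t ^+ 2) =
     ((x - u) ^+ 2 + h ^+ 2 + v ^+ 2) ^+ 2 - 4 * s ^+ 2 * v ^+ 2.
    by rewrite h2; ring.
  have -> : s ^+ 2 = h ^+ 2 - t ^+ 2 by rewrite h2; ring.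
  by field; rewrite !gt_eqF.
have c0 : 0 < 2 * complex.Im a * coshd (proj_H2 w) a + 2 * complex.Im a.
  by rewrite addr_gt0 // !mulr_gt0.
have d0 : 0 < complex.Im (proj_H2 w) * w.2 ^+ 2 by rewrite mulr_gt0 ?exprn_gt0.
split.
  rewrite -ler_expR -subr_ge0 E; apply: divr_ge0; last exact: ltW.
  by apply: mulr_ge0; rewrite ?sqn_ge0 // mulr_ge0 ?sqr_ge0 // ltW.
rewrite -[LHS](inj_eq (@expR_inj R)) eq_sym -[LHS]subr_eq0 E.
rewrite mulf_eq0 invr_eq0 (gt_eqF d0) orbF mulf_eq0 sqn_eq0 subr_eq0.
by rewrite mulf_eq0 (gt_eqF c0) orbF sqrf_eq0.
Qed.

(** If the projection of [w] is not [P], projecting does not increase the sum and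
    moving on to [P] decreases it.  If the projection is [P] but [w] is not on the
    half-plane, projecting decreases the term of any root other than [P]. *)
Lemma julia_minimizer V U P :
    perm_eq V (U ++ map (@conjc R) U) -> {in U, forall a, H2 a} -> H2 P ->
    (forall Q, H2 Q ->
      \sum_(a <- U) coshd Q a / coshd P a = (size U)%:R * coshd Q P) ->
    has (predC1 P) U ->
  the_minimizer (0, 0) H3 (fun w => \sum_(b <- V) hdist3 w b) = H2_to_H3 P.
Proof.
move=> VU UH HP sumE /hasP[a0 a0U /= a0P].
have U0 : U != [::] by apply: contraTneq a0U => ->.
have JE w : \sum_(b <- V) hdist3 w b =
    \sum_(a <- U) (hdist3 w a + hdist3 w (conjc a)).
  by rewrite (perm_big _ VU) big_cat big_map big_split.
pose L q := \sum_(a <- U) 2 * ln (2 * complex.Im a * coshd q a).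
have JP : \sum_(b <- V) hdist3 (H2_to_H3 P) b = L P.
  rewrite JE /L big_seq [RHS]big_seq; apply: eq_bigr => a /UH Ha.
  exact: hdist3_H2_to_H3.
have le_term w a : H3 w -> a \in U ->
    2 * ln (2 * complex.Im a * coshd (proj_H2 w) a) <= hdist3 w a + hdist3 w (conjc a).
  by move=> Hw /UH Ha; exact: (hdist3_proj_H2 Hw Ha).1.
have Lproj w : H3 w -> L (proj_H2 w) <= \sum_(b <- V) hdist3 w b.
  move=> Hw; rewrite JE /L big_seq [leRHS]big_seq; apply: ler_sum => a aU.
  exact: le_term.
have L_lt q : H2 q -> q != P -> L P < L q.
  move=> Hq qP; rewrite -subr_gt0 /L -sumrB.
  have -> : \sum_(a <- U) (2 * ln (2 * complex.Im a * coshd q a)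
      - 2 * ln (2 * complex.Im a * coshd P a)) =
      2 * \sum_(a <- U) ln (coshd q a / coshd P a).
    rewrite mulr_sumr big_seq [RHS]big_seq; apply: eq_bigr => a /UH Ha.
    have v0 : 0 < 2 * complex.Im a by rewrite mulr_gt0.
    rewrite -mulrBr ln_div ?lnM ?posrE ?coshd_gt0 //.
    by congr (_ * _); ring.
  by rewrite mulr_gt0 // sum_ln_ratio_gt0 ?sumE // eq_sym.
apply: the_minimizer_eq; first exact: HP.
move=> w Hw wP; rewrite JP; have Hp := H2_proj_H2 Hw.
have [pP|pP] := eqVneq (proj_H2 w) P; last exact: lt_le_trans (L_lt _ Hp pP) (Lproj _ Hw).
have s0 : complex.Im w.1 != 0.
  apply: contra_not_neq wP => s0; rewrite -pP /proj_H2 s0 expr0n add0r /H2_to_H3 /=.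
  rewrite sqrtr_sqr gtr0_norm //.
  by case: w s0 {Hw Hp pP} => [[x s] t] /= ->.
rewrite -pP JE /L (big_rem _ a0U) [ltRHS](big_rem _ a0U) /=.
apply: ltr_leD.
  rewrite (lt_leif (hdist3_proj_H2 Hw (UH _ a0U))) negb_or s0 pP.
  by rewrite eq_sym.
rewrite big_seq [leRHS]big_seq; apply: ler_sum => a /mem_rem aU.
exact: le_term.
Qed.

End Julia.

(** * Roots of totally complex forms *)

Section Forms.
Context {R : realType}.
Implicit Types (F : mpoly.mpoly 2 R) (p : {poly R[i]}).

Lemma form_atE F x z : form_at F x z =
  \sum_(m <- mpoly.msupp F) mpoly.mcoeff m F * (x ^+ m ord0 * z ^+ m ord_max).
Proof.
rewrite /form_at mpoly.mevalE; apply: eq_bigr => m _; congr (_ * _).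
rewrite !big_ord_recl big_ord0 mulr1 /=.
by congr (_ * _ ^+ m _); apply: val_inj.
Qed.

(** Keeping the real coefficients apart makes both the conjugation symmetry of
    the roots and the absence of real roots immediate. *)
Definition real_dehomog F : {poly R} :=
  \sum_(m <- mpoly.msupp F) mpoly.mcoeff m F *: 'X^(m ord0).

Lemma dehomogE F : dehomog F = map_poly (real_complex R) (real_dehomog F).
Proof.
rewrite /dehomog /real_dehomog /mpoly.mmap rmorph_sum; apply: eq_bigr => m _ /=.
rewrite map_polyZ map_polyXn -mul_polyC; congr (_ * _).
rewrite /mpoly.mmap1 !big_ord_recl big_ord0 mulr1 /=.
by rewrite expr1n mulr1.
Qed.

Lemma horner_real_dehomog F x : (real_dehomog F).[x] = form_at F x 1.
Proof.
rewrite form_atE horner_sum; apply: eq_bigr => m _.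
by rewrite hornerZ hornerXn expr1n mulr1.
Qed.

(** The coefficient of degree [N] is the value of the form at the point at
    infinity (1 : 0), which is not a root. *)
Lemma size_dehomog N F : F \is mpoly.ishomog1 N mpoly.mdeg ->
  totally_complex F -> size (dehomog F) = N.+1.
Proof.
move=> /mpoly.dhomogP Fh Ftc; rewrite dehomogE size_map_poly.
have degE m : m \in mpoly.msupp F -> (m ord0 + m ord_max = N)%N.
  move=> mF; have -> : N = mpoly.mdeg m by rewrite -(Fh m mF).
  rewrite mpoly.mdegE !big_ord_recl big_ord0 addn0.
  by congr (_ + m _)%N; apply: val_inj.
apply/eqP; rewrite eqn_leq; apply/andP; split.
  apply: (leq_trans (size_sum _ _ _)); apply/bigmax_leqP_seq => m mF _.
  rewrite (leq_trans (size_scale_leq _ _)) // size_polyXn ltnS -(degE m mF).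
  exact: leq_addr.
suff cN : (real_dehomog F)`_N != 0.
  by rewrite ltnNge; apply: contra cN => /leq_sizeP ->.
have -> : (real_dehomog F)`_N = form_at F 1 0.
  rewrite form_atE coef_sum big_seq [RHS]big_seq; apply: eq_bigr => m /degE dm.
  rewrite coefZ coefXn expr1n mul1r expr0n (_ : (N == m ord0) = (m ord_max == 0%N)) //.
  by rewrite -dm -[RHS](eqn_add2l (m ord0)) addn0.
by apply/eqP/Ftc => -[/eqP]; rewrite oner_eq0.
Qed.

Lemma dehomog_conj F : map_poly (@conjc R) (dehomog F) = dehomog F.
Proof.
rewrite dehomogE -map_poly_comp; apply: eq_map_poly => x /=; exact: conjc_real.
Qed.

Lemma root_dehomog_Im F b : totally_complex F -> root (dehomog F) b ->
  complex.Im b != 0.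
Proof.
move=> Ftc; apply: contraTneq; case: b => x y /= ->; rewrite dehomogE.
rewrite /root (_ : x +i* 0 = real_complex R x) // horner_map /=.
rewrite fmorph_eq0 horner_real_dehomog; apply/eqP/Ftc => -[_ /eqP].
by rewrite oner_eq0.
Qed.

Lemma mup_prod_XsubC (K : fieldType) (c x : K) (s : seq K) : c != 0 ->
  mup x (c *: \prod_(z <- s) ('X - z%:P)) = count_mem x s.
Proof.
move=> c0; rewrite -mul_polyC mupMr; last by rewrite /root hornerC.
elim: s => [|z s IH]; first by rewrite big_nil mupNroot // root1.
rewrite big_cons mupM ?polyXsubC_eq0 //; last first.
  by rewrite -size_poly_eq0 size_prod_XsubC.
rewrite IH -['X - _]expr1 mup_XsubCX /=.
by case: eqP.
Qed.

Lemma complex_rootsP F :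
  dehomog F = lead_coef (dehomog F) *: \prod_(z <- complex_roots F) ('X - z%:P).
Proof. exact: svalP (closed_field_poly_normal (dehomog F)). Qed.

Lemma mup_dehomog F x : dehomog F != 0 ->
  mup x (dehomog F) = count_mem x (complex_roots F).
Proof.
by move=> F0; rewrite {1}complex_rootsP mup_prod_XsubC // lead_coef_eq0.
Qed.

Lemma size_complex_roots F : dehomog F != 0 ->
  size (complex_roots F) = (size (dehomog F)).-1.
Proof.
move=> F0; rewrite [in RHS]complex_rootsP size_scale ?lead_coef_eq0 //.
by rewrite size_prod_XsubC.
Qed.

(** The multiplicity of a root determines how often it is listed, and conjugating
    a real polynomial does not change it. *)
Lemma perm_complex_roots_conj F : dehomog F != 0 ->
  perm_eq (map (@conjc R) (complex_roots F)) (complex_roots F).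
Proof.
move=> F0; apply/allP => x _ /=; rewrite -mup_dehomog // -dehomog_conj.
rewrite [in X in _ == X]complex_rootsP map_polyZ rmorph_prod.
rewrite (eq_bigr (fun z => 'X - (conjc z)%:P)); last first.
  by move=> z _; rewrite rmorphB /= map_polyX map_polyC.
rewrite -(big_map (@conjc R) xpredT (fun z => 'X - z%:P)) mup_prod_XsubC //.
by rewrite fmorph_eq0 lead_coef_eq0.
Qed.

Lemma perm_complex_roots F : dehomog F != 0 -> totally_complex F ->
  perm_eq (complex_roots F) (upper_roots F ++ map (@conjc R) (upper_roots F)).
Proof.
move=> F0 Ftc; rewrite /upper_roots.
set up := fun z : R[i] => 0 < complex.Im z.
rewrite -(perm_filterC up) perm_cat2l.
have -> : map (@conjc R) [seq z <- complex_roots F | up z] =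
          [seq z <- map (@conjc R) (complex_roots F) | predC up z].
  rewrite filter_map; congr map; apply: eq_in_filter => z zF /=.
  have : complex.Im z != 0.
    apply: (root_dehomog_Im Ftc).
    by rewrite complex_rootsP rootZ ?lead_coef_eq0 // root_prod_XsubC.
  rewrite /up; case: z {zF} => x y /= y0.
  by rewrite -leNgt oppr_le0 le_eqVlt eq_sym (negPf y0).
by apply: perm_filter; rewrite perm_sym; exact: perm_complex_roots_conj.
Qed.

Lemma root_dehomog F b : dehomog F != 0 ->
  root (dehomog F) b = (b \in complex_roots F).
Proof.
by move=> F0; rewrite complex_rootsP rootZ ?lead_coef_eq0 // root_prod_XsubC.
Qed.

Lemma upper_roots_H2 F : {in upper_roots F, forall a, H2 a}.
Proof. by move=> a; rewrite mem_filter => /andP[]. Qed.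

Lemma size_upper_roots n F : totally_complex F ->
  size (dehomog F) = (2 * n).+1 -> size (upper_roots F) = n.
Proof.
move=> Ftc sF; have F0 : dehomog F != 0 by rewrite -size_poly_eq0 sF.
have := perm_size (perm_complex_roots F0 Ftc).
rewrite size_complex_roots // sF size_cat size_map addnn -mul2n /=.
by move/eqP; rewrite eqn_pmul2l // => /eqP.
Qed.

Lemma count_conj_upper F b : 0 < complex.Im b ->
  count_mem b (map (@conjc R) (upper_roots F)) = 0%N.
Proof.
move=> b0; apply/count_memPn/mapP => -[[x y] /upper_roots_H2].
by rewrite /H2 /= => y0 bE; move: b0; rewrite bE /= oppr_gt0 ltNge ltW.
Qed.

Lemma count_upper F b : complex.Im b < 0 -> count_mem b (upper_roots F) = 0%N.
Proof.
move=> b0; apply/count_memPn; apply/negP => /upper_roots_H2.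
by rewrite /H2 /= ltNge ltW.
Qed.

(** The [2 * n] roots are [n] conjugate pairs without real points, so a root of
    multiplicity at least [n], or its conjugate, fills the whole list of upper
    roots.  The degree is full, so infinity is not a root. *)
Lemma stableE n F : (0 < n)%N -> totally_complex F ->
  size (dehomog F) = (2 * n).+1 ->
  stable (2 * n) F <-> ~ exists c, all (pred1 c) (upper_roots F).
Proof.
move=> n0 Ftc sF; have F0 : dehomog F != 0 by rewrite -size_poly_eq0 sF.
have sU := size_upper_roots Ftc sF.
have mupE b : mup b (dehomog F) = (count_mem b (upper_roots F) +
    count_mem b (map (@conjc R) (upper_roots F)))%N.
  by rewrite mup_dehomog // (permP (perm_complex_roots F0 Ftc)) count_cat.
split=> [[Fst _] [c Uc] | Uc].
  have cE : count_mem c (upper_roots F) = n.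
    by move: Uc; rewrite all_count sU => /eqP.
  suff /Fst : root (dehomog F) c by rewrite mupE cE ltn_pmul2l // ltnNge leq_addr.
  have : c \in upper_roots F by rewrite -has_pred1 has_count cE.
  by rewrite root_dehomog // mem_filter => /andP[].
split; last by rewrite sF /= ltnn.
move=> b /(root_dehomog_Im Ftc) b0; rewrite ltn_pmul2l // ltnNge.
apply/negP; rewrite mupE => nb; apply: Uc.
have full c : (n <= count_mem c (upper_roots F))%N -> all (pred1 c) (upper_roots F).
  by rewrite all_count sU eqn_leq => ->; rewrite andbT -sU count_size.
move: b0; rewrite neq_lt => /orP[b0|b0]; move: nb.
  rewrite count_upper // add0n => nb; exists (conjc b); apply: full.
  rewrite (leq_trans nb) // count_map; apply: sub_count => z /= /eqP <-.
  by rewrite /= conjcK.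
by rewrite count_conj_upper // addn0 => nb; exists b; exact: full.
Qed.

End Forms.

Theorem proposition10 (R : realType) (n : nat) (F : mpoly.mpoly 2 R)
    (G : set 'M[R]_2) (P : R[i])
    (n_gt0 : (0 < n)%N)
    (F_homog : F \is mpoly.ishomog1 (2 * n) mpoly.mdeg)
    (F_tc : totally_complex F)
    (G_subgroup : SL2_subgroup G)
    (G_preserves : forall M, G M ->
       perm_eq [seq ract z M | z <- upper_roots F] (upper_roots F))
    (P_fixed : [set Q | H2 Q /\ forall M, G M -> ract Q M = Q] = [set P]) :
  julia_zero (2 * n) F = H2_to_H3 P /\ hyperbolic_zero F = P.
Proof.
have sF := size_dehomog F_homog F_tc.
have F0 : dehomog F != 0 by rewrite -size_poly_eq0 sF.
have UH := @upper_roots_H2 _ F.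
have U_neq0 : upper_roots F != [::].
  by rewrite -size_eq0 (size_upper_roots F_tc sF) -lt0n.
have [HP PG] : H2 P /\ forall M, G M -> ract P M = P.
  by have : [set P] P by []; rewrite -P_fixed.
have P_unique Q : H2 Q -> (forall M, G M -> ract Q M = Q) -> Q = P.
  by move=> HQ QG; suff : [set P] Q by []; rewrite -P_fixed.
have [detG _ _ _] := G_subgroup.
split; last first.
  apply: the_minimizer_eq => // Q HQ QP.
  have [C C0 fE] := sum_coshd U_neq0 UH detG G_preserves P_unique.
  have fE' q : H2 q -> \sum_(a <- upper_roots F) Defs.cosh (hdist2 q a) = C * coshd q P.
    move=> Hq; rewrite -fE // big_seq [RHS]big_seq.
    by apply: eq_bigr => a /UH Ha; rewrite cosh_hdist2.
  by rewrite !fE' // ltr_pM2l // coshdxx coshd_gt1 //; apply/eqP.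
rewrite /julia_zero; case: asboolP => [|/(stableE n_gt0 F_tc sF)/contrapT[c Uc]].
  move=> /(stableE n_gt0 F_tc sF) Fst.
  apply: (julia_minimizer (perm_complex_roots F0 F_tc) UH HP).
    by move=> Q HQ; apply: (sum_coshd_ratio U_neq0 UH detG G_preserves PG).
  by rewrite has_predC; apply/negP => UP; apply: Fst; exists P.
have hU : head 0 (upper_roots F) \in upper_roots F.
  by case: (upper_roots F) U_neq0 => // a s _; rewrite inE eqxx.
congr H2_to_H3; apply: P_unique; first exact: UH.
move=> M GM; rewrite [RHS](eqP (allP Uc _ hU)); apply/eqP/(allP Uc).
by rewrite -(perm_mem (G_preserves M GM)) (map_f (fun z => ract z M)).
Qed.
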